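(* Let $q$ satisfy the RDE $dq_t=f(q_t)\,dt+\sigma(q_t)\,d\mathbf{Z}_t$ driven by a geometric rough path $\mathbf{Z}$. Then rough Runge–Kutta discretisation commutes with the formation of variational equations. That is, the rough Runge–Kutta method $$\delta Q_{i,k}=\delta q_k+\Delta t\sum_{j=1}^sa_{ij}\frac{\partial f}{\partial q}(Q_{j,k})\,\delta Q_{j,k}+\sum_{j=1}^s\bar a_{ij}\frac{\partial\sigma}{\partial q}(Q_{j,k})\,\delta Q_{j,k}\cdot Z_{t_k,t_{k+1}},\quad i=1,\dots,s,$$ $$\delta q_{k+1}=\delta q_k+\Delta t\sum_{i=1}^sb_i\frac{\partial f}{\partial q}(Q_{i,k})\,\delta Q_{i,k}+\sum_{i=1}^s\bar b_i\frac{\partial\sigma}{\partial q}(Q_{i,k})\,\delta Q_{i,k}\cdot Z_{t_k,t_{k+1}}$$ for the rough variational equation $d\,\delta q_t=\frac{\partial f}{\partial q}(q_t)\,\delta q_t\,dt+\frac{\partial\sigma}{\partial q}(q_t)\,\delta q_t\,d\mathbf{Z}_t$ is the perturbation of initial conditions (i.e. the derivative at $\varepsilon=0$ with respect to $\varepsilon$ when the initial condition is replaced by $q_0+\varepsilon\,\delta q_0$) in the rough Runge–Kutta method $$Q_{i,k}=q_k+\Delta t\sum_{j=1}^sa_{ij}f(Q_{j,k})+\sum_{j=1}^s\bar a_{ij}\sigma(Q_{j,k})\cdot Z_{t_k,t_{k+1}},\quad i=1,\dots,s,$$ $$q_{k+1}=q_k+\Delta t\sum_{i=1}^sb_if(Q_{i,k})+\sum_{i=1}^s\bar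 b_i\sigma(Q_{i,k})\cdot Z_{t_k,t_{k+1}}$$ for the RDE.
   Context: $\mathbf{Z}=(Z,\mathbb{Z})$ is a geometric $\alpha$-Hölder rough path in $\mathbb{R}^K$, $\alpha\in(\frac13,\frac12]$, with increments $Z_{t_k,t_{k+1}}=Z_{t_{k+1}}-Z_{t_k}$ on a uniform grid of step $\Delta t$; ''$\cdot Z_{t_k,t_{k+1}}$'' is contraction over the $\mathbb{R}^K$ index. $f\in C^\infty(\mathbb{R}^N,\mathbb{R}^N)$, $\sigma\in C^\infty(\mathbb{R}^N,\mathcal{L}(\mathbb{R}^K,\mathbb{R}^N))$. $a_{ij},\bar a_{ij},b_i,\bar b_i$ are real Runge–Kutta coefficients, and the stage equations are understood to define a one-step map $q_k\mapsto q_{k+1}$ (and stages $Q_{i,k}$) that depends smoothly on $q_k$. *)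

(* Defs.v *)
From HB Require Import structures.
From mathcomp Require Import all_boot all_order all_algebra.
From mathcomp Require Import all_classical all_reals all_analysis.
Import Order.TTheory GRing.Theory Num.Theory.
Import numFieldNormedType.Exports.
Set Implicit Arguments.
Unset Strict Implicit.
Unset Printing Implicit Defensive.
Local Open Scope classical_set_scope.
Local Open Scope ring_scope.

(* For an open set [D] in finite dimension this is C^k regularity on [D]: the
   maps [x |-> 'd f x v], with [v] fixed, are the directional derivatives. *)
Fixpoint Ck_on (R : realType) (V W : normedModType R) (k : nat) (D : set V)
    (f : V -> W) : Prop :=
  if k is k'.+1 then
    (forall x, D x -> differentiable f x) /\
    (forall v : V, Ck_on k' D (fun x => 'd f x v))
  else forall x, D x -> {for x, continuous f}.

Definition smooth_on (R : realType) (V W : normedModType R) (D : set V)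
    (f : V -> W) : Prop :=
  forall k, Ck_on k D f.

Definition holder (R : realType) (W : normedModType R) (T beta : R)
    (X : R -> R -> W) : Prop :=
  exists C : R, forall u v : R, 0 <= u -> u <= v -> v <= T ->
    `|X u v| <= C * (v - u) `^ beta.

Definition incr (R : realType) (W : normedModType R) (Y : R -> W) (u v : R) : W :=
  Y v - Y u.

(* [ZZ u v i j] is the iterated integral of [Z^i - Z^i_u] against [dZ^j] over
   [u, v].  The conditions are the two Hoelder bounds, Chen's relation, and
   geometricity: the symmetric part of [ZZ u v] is half the tensor square of
   the increment of [Z]. *)
Definition geometric_rough_path (R : realType) (K : nat) (alpha T : R)
    (Z : R -> 'cV[R]_K) (ZZ : R -> R -> 'M[R]_K) : Prop :=
  [/\ holder T alpha (incr Z),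
      holder T (2 * alpha) ZZ,
      forall u v w : R, 0 <= u -> u <= v -> v <= w -> w <= T ->
        ZZ u w = ZZ u v + ZZ v w + incr Z u v *m (incr Z v w)^T
    & forall u v : R, 0 <= u -> u <= v -> v <= T ->
        ZZ u v + (ZZ u v)^T = incr Z u v *m (incr Z u v)^T].

(* [Y' u j] is the value of the Gubinelli derivative of [Y] at time [u] on the
   [j]-th basis vector of R^K. *)
Definition controlled (R : realType) (K : nat) (W : normedModType R)
    (alpha T : R) (Z : R -> 'cV[R]_K) (Y : R -> W) (Y' : R -> 'I_K -> W) : Prop :=
  [/\ holder T alpha (incr Y),
      forall j, holder T alpha (incr (fun u => Y' u j))
    & holder T (2 * alpha)
        (fun u v => incr Y u v - \sum_(j < K) incr Z u v j 0 *: Y' u j)].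

(* [is_rough_integral Z ZZ Y Y' a b J]: the compensated Riemann sums
   of the L(R^K, R^N)-valued integrand [(Y, Y')] over partitions of [a, b]
   converge to [J] as the mesh goes to 0. *)
Definition is_rough_integral (R : realType) (N K : nat) (Z : R -> 'cV[R]_K)
    (ZZ : R -> R -> 'M[R]_K) (Y : R -> 'M[R]_(N, K))
    (Y' : R -> 'I_K -> 'M[R]_(N, K)) (a b : R) (J : 'cV[R]_N) : Prop :=
  forall eps : R, 0 < eps -> exists2 eta : R, 0 < eta &
    forall p : seq R, itv_partition a b p ->
      let u k := nth b (a :: p) k in
      (forall k, (k < size p)%N -> u k.+1 - u k < eta) ->
      `| \sum_(k < size p)
           (Y (u k) *m incr Z (u k) (u k.+1)
            + \sum_(j < K) Y' (u k) j *m (row j (ZZ (u k) (u k.+1)))^T)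
         - J | < eps.

(* [q] solves dq = f(q) dt + sigma(q) dZ on [0, T]: [(q, sigma(q))] is
   controlled by [Z], and the integral equation holds, [sigma(q)] having
   Gubinelli derivative [z |-> Dsigma(q)(sigma(q) z)]. *)
Definition rde_solution (R : realType) (N K : nat) (alpha T : R)
    (Z : R -> 'cV[R]_K) (ZZ : R -> R -> 'M[R]_K)
    (f : 'cV[R]_N -> 'cV[R]_N) (sigma : 'cV[R]_N -> 'M[R]_(N, K))
    (q : R -> 'cV[R]_N) : Prop :=
  controlled alpha T Z q (fun u j => col j (sigma (q u))) /\
  forall t : R, 0 <= t -> t <= T ->
    is_rough_integral Z ZZ (fun u => sigma (q u))
      (fun u j => 'd sigma (q u) (col j (sigma (q u)))) 0 t
      (q t - q 0 -
       \col_(i < N) Rintegral lebesgue_measure `[0, t] (fun u => f (q u) i 0)).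

Record rk_coeffs (R : realType) (s : nat) := RKCoeffs {
  rk_a : 'I_s -> 'I_s -> R;
  rk_abar : 'I_s -> 'I_s -> R;
  rk_b : 'I_s -> R;
  rk_bbar : 'I_s -> R }.

Definition rk_stage_eqs (R : realType) (N K s : nat) (c : rk_coeffs R s)
    (f : 'cV[R]_N -> 'cV[R]_N) (sigma : 'cV[R]_N -> 'M[R]_(N, K))
    (dt : R) (dz : 'cV[R]_K) (q : 'cV[R]_N) (Q : 'I_s -> 'cV[R]_N) : Prop :=
  forall i, Q i = q + dt *: (\sum_(j < s) rk_a c i j *: f (Q j))
                    + \sum_(j < s) rk_abar c i j *: (sigma (Q j) *m dz).

Definition rk_update (R : realType) (N K s : nat) (c : rk_coeffs R s)
    (f : 'cV[R]_N -> 'cV[R]_N) (sigma : 'cV[R]_N -> 'M[R]_(N, K))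
    (dt : R) (dz : 'cV[R]_K) (q : 'cV[R]_N) (Q : 'I_s -> 'cV[R]_N) : 'cV[R]_N :=
  q + dt *: (\sum_(i < s) rk_b c i *: f (Q i))
    + \sum_(i < s) rk_bbar c i *: (sigma (Q i) *m dz).

Definition rough_rk (R : realType) (N K s : nat) (c : rk_coeffs R s)
    (f : 'cV[R]_N -> 'cV[R]_N) (sigma : 'cV[R]_N -> 'M[R]_(N, K))
    (n : nat) (dt : R) (dZ : nat -> 'cV[R]_K)
    (q : nat -> 'cV[R]_N) (Q : nat -> 'I_s -> 'cV[R]_N) : Prop :=
  forall k, (k < n)%N ->
    rk_stage_eqs c f sigma dt (dZ k) (q k) (Q k) /\
    q k.+1 = rk_update c f sigma dt (dZ k) (q k) (Q k).

Definition var_stage_eqs (R : realType) (N K s : nat) (c : rk_coeffs R s)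
    (f : 'cV[R]_N -> 'cV[R]_N) (sigma : 'cV[R]_N -> 'M[R]_(N, K))
    (dt : R) (dz : 'cV[R]_K) (Q : 'I_s -> 'cV[R]_N)
    (dq : 'cV[R]_N) (dQ : 'I_s -> 'cV[R]_N) : Prop :=
  forall i, dQ i = dq
    + dt *: (\sum_(j < s) rk_a c i j *: ('d f (Q j) (dQ j)))
    + \sum_(j < s) rk_abar c i j *: ('d sigma (Q j) (dQ j) *m dz).

Definition var_update (R : realType) (N K s : nat) (c : rk_coeffs R s)
    (f : 'cV[R]_N -> 'cV[R]_N) (sigma : 'cV[R]_N -> 'M[R]_(N, K))
    (dt : R) (dz : 'cV[R]_K) (Q : 'I_s -> 'cV[R]_N)
    (dq : 'cV[R]_N) (dQ : 'I_s -> 'cV[R]_N) : 'cV[R]_N :=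
  dq + dt *: (\sum_(i < s) rk_b c i *: ('d f (Q i) (dQ i)))
     + \sum_(i < s) rk_bbar c i *: ('d sigma (Q i) (dQ i) *m dz).

Definition variational_rough_rk (R : realType) (N K s : nat)
    (c : rk_coeffs R s)
    (f : 'cV[R]_N -> 'cV[R]_N) (sigma : 'cV[R]_N -> 'M[R]_(N, K))
    (n : nat) (dt : R) (dZ : nat -> 'cV[R]_K) (Q : nat -> 'I_s -> 'cV[R]_N)
    (dq : nat -> 'cV[R]_N) (dQ : nat -> 'I_s -> 'cV[R]_N) : Prop :=
  forall k, (k < n)%N ->
    var_stage_eqs c f sigma dt (dZ k) (Q k) (dq k) (dQ k) /\
    dq k.+1 = var_update c f sigma dt (dZ k) (Q k) (dq k) (dQ k).

(* On the open set [D], [S] is a choice, smooth in the initial point, of a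
   solution of the (in general implicit) stage equations; the one-step map is
   then [q |-> rk_update c f sigma dt dz q (S q)]. *)
Definition smooth_stage_map (R : realType) (N K s : nat) (c : rk_coeffs R s)
    (f : 'cV[R]_N -> 'cV[R]_N) (sigma : 'cV[R]_N -> 'M[R]_(N, K))
    (dt : R) (dz : 'cV[R]_K)
    (D : set 'cV[R]_N) (S : 'cV[R]_N -> 'I_s -> 'cV[R]_N) : Prop :=
  [/\ open D,
      forall x, D x -> rk_stage_eqs c f sigma dt dz x (S x)
    & forall i, smooth_on D (fun x => S x i)].

Fixpoint rk_iter (R : realType) (N K s : nat) (c : rk_coeffs R s)
    (f : 'cV[R]_N -> 'cV[R]_N) (sigma : 'cV[R]_N -> 'M[R]_(N, K))
    (dt : R) (dZ : nat -> 'cV[R]_K)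
    (S : nat -> 'cV[R]_N -> 'I_s -> 'cV[R]_N) (x : 'cV[R]_N) (k : nat) :
    'cV[R]_N :=
  if k is k'.+1 then
    let y := rk_iter c f sigma dt dZ S x k' in
    rk_update c f sigma dt (dZ k') y (S k' y)
  else x.

(* [(dq, dQ)] is the derivative at [e = 0] of the family [(q e, Q e)] of
   discrete trajectories of [n] steps. *)
Definition is_perturbation (R : realType) (N s n : nat)
    (q : R -> nat -> 'cV[R]_N) (Q : R -> nat -> 'I_s -> 'cV[R]_N)
    (dq : nat -> 'cV[R]_N) (dQ : nat -> 'I_s -> 'cV[R]_N) : Prop :=
  (forall k, (k <= n)%N ->
     is_derive (0 : R) (1 : R) (fun e => q e k) (dq k)) /\
  (forall k i, (k < n)%N ->
     is_derive (0 : R) (1 : R) (fun e => Q e k i) (dQ k i)).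

Definition tangent (R : realType) (N m : nat) (g : 'cV[R]_N -> 'M[R]_(N, m))
    (x : 'cV[R]_(N + N)) : 'M[R]_(N + N, m) :=
  col_mx (g (usubmx x)) ('d g (usubmx x) (dsubmx x)).

Lemma sum_col_mx (R : realType) (N m s : nat) (w : 'I_s -> R)
    (A B : 'I_s -> 'M[R]_(N, m)) :
  \sum_j w j *: col_mx (A j) (B j) =
  col_mx (\sum_j w j *: A j) (\sum_j w j *: B j).
Proof.
transitivity (\sum_j col_mx (w j *: A j) (w j *: B j)).
  by apply: eq_bigr => j _; rewrite scale_col_mx.
by apply: (big_ind3 (fun X Y W => X = col_mx Y W)) => //;
  [rewrite col_mx0|move=> X1 X2 X3 Y1 Y2 Y3 -> ->; rewrite add_col_mx].
Qed.

(* [variational_rough_rk] is the rough Runge-Kutta method for the variational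
   equation: adjoined to [rough_rk] it is the method applied to the system
   formed by the RDE and its variational equation. *)
Lemma rough_rk_tangent (R : realType) (N K s : nat) (c : rk_coeffs R s)
    (f : 'cV[R]_N -> 'cV[R]_N) (sigma : 'cV[R]_N -> 'M[R]_(N, K))
    (n : nat) (dt : R) (dZ : nat -> 'cV[R]_K)
    (q : nat -> 'cV[R]_N) (Q : nat -> 'I_s -> 'cV[R]_N)
    (dq : nat -> 'cV[R]_N) (dQ : nat -> 'I_s -> 'cV[R]_N) :
  rough_rk c (tangent f) (tangent sigma) n dt dZ
    (fun k => col_mx (q k) (dq k)) (fun k i => col_mx (Q k i) (dQ k i)) <->
  rough_rk c f sigma n dt dZ q Q /\
  variational_rough_rk c f sigma n dt dZ Q dq dQ.
Proof.
have E k (y dy : 'cV[R]_N) (w w' : 'I_s -> R) :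
    col_mx y dy
      + dt *: (\sum_j w j *: tangent f (col_mx (Q k j) (dQ k j)))
      + \sum_j w' j *: (tangent sigma (col_mx (Q k j) (dQ k j)) *m dZ k) =
    col_mx
      (y + dt *: (\sum_j w j *: f (Q k j))
         + \sum_j w' j *: (sigma (Q k j) *m dZ k))
      (dy + dt *: (\sum_j w j *: ('d f (Q k j) (dQ k j)))
          + \sum_j w' j *: ('d sigma (Q k j) (dQ k j) *m dZ k)).
  under eq_bigr do rewrite /tangent col_mxKu col_mxKd.
  under [X in _ + X = _]eq_bigr do
    rewrite /tangent col_mxKu col_mxKd mul_col_mx.
  by rewrite !sum_col_mx scale_col_mx !add_col_mx.
split=> [H|[H1 H2] k kn].
  split=> k kn; have [Hs Hu] := H k kn; move: Hu;
    rewrite /rk_update E => /eq_col_mx[Hu Hd]; split=> // i;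
    by have := Hs i; rewrite E => /eq_col_mx[].
have [[S1 U1] [S2 U2]] := (H1 k kn, H2 k kn).
split=> [i|]; rewrite /rk_update E.
  by rewrite S1 S2.
by rewrite U1 U2.
Qed.

(* Main.v *)
Require Import Defs.
From HB Require Import structures.
From mathcomp Require Import all_boot all_order all_algebra.
From mathcomp Require Import all_classical all_reals all_analysis.
Import Order.TTheory GRing.Theory Num.Theory.
Import numFieldNormedType.Exports.
Local Open Scope classical_set_scope.
Local Open Scope ring_scope.

(** One step of the method is assembled from the stages by operations that
    commute with differentiation along a curve: adding, scaling, applying [f]
    and [sigma] (chain rule) and contracting with a fixed increment of the
    driver.  Only finitely many increments of the path enter, and they do not
    depend on the initial condition, so the argument is pathwise and purely
    finite-dimensional.

    The one delicate point is that the stages are given implicitly.  Since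
    [S] solves the stage equations on an open set, both sides of these
    equations are differentiable along a line through any of its points and
    agree near that point; equating their derivatives says exactly that the
    derivative of the stages solves the variational stage equations
    ([var_stage_eqs_dstages]).  Smoothness of [S] plays the part of the
    implicit function theorem.

    Induction on the step then shows that the discrete flow is differentiable
    in the direction of the perturbation, and that its derivative obeys the
    variational update ([is_derive_rk_iter]).  Conversely, if the linear stage
    systems are uniquely solvable then the variational method has one
    trajectory for each initial perturbation
    ([variational_rough_rk_inj]), so this trajectory must be the derivative. *)

Set Implicit Arguments.
Unset Strict Implicit.

(** * Differentiation along curves *)

Lemma smooth_on_differentiable (R : realType) (V W : normedModType R)
    (D : set V) (f : V -> W) (x : V) :
  smooth_on D f -> D x -> differentiable f x.
Proof. by move=> /(_ 1%N)[fD _]; exact: fD. Qed.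

Section curves.
Context {R : realType}.
Implicit Type t : R.

(** Over the one-dimensional source [R] derivability and differentiability
    coincide, so the chain rule for differentials applies to curves. *)
Lemma is_derive_comp_curve (V W : normedModType R) (g : V -> W) (y : R -> V)
    t (dy : V) :
  is_derive t 1 y dy -> differentiable g (y t) ->
  is_derive t 1 (fun e => g (y e)) ('d g (y t) dy).
Proof.
move=> dy_y dg.
have diffy : differentiable y t by apply/derivable1_diffP; exact: ex_derive.
have diffgy : differentiable (g \o y) t by exact: differentiable_comp.
apply: DeriveDef; first exact/derivable1_diffP.
rewrite (deriveE _ diffgy) diff_comp //= -(deriveE _ diffy).
by rewrite (@derive_val _ _ _ _ _ _ _ dy_y).
Qed.

(** Reduces the calculus of matrix-valued curves to that of real functions,
    where contraction with a constant matrix becomes a finite sum. *)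
Lemma is_derive_mxP (m p : nat) (M : R -> 'M[R]_(m, p)) t (dM : 'M[R]_(m, p)) :
  is_derive t 1 M dM <->
  forall i j, is_derive t 1 (fun e => M e i j) (dM i j).
Proof.
split=> [HM i j|HM].
  have dM_M : derivable M t 1 by exact: ex_derive.
  apply: DeriveDef; first exact: (derivable_mxP M t 1).1.
  by rewrite -[in RHS](@derive_val _ _ _ _ _ _ _ HM) derive_mx// mxE.
have dM_M : derivable M t 1.
  by apply/derivable_mxP => i j; have [] := HM i j.
apply: DeriveDef => //; rewrite derive_mx//; apply/matrixP => i j.
by rewrite mxE; exact: (@derive_val _ _ _ _ _ _ _ (HM i j)).
Qed.

Lemma is_derive_sumE (V : normedModType R) (m : nat) (h : 'I_m -> R -> V) t
    (dh : 'I_m -> V) :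
  (forall i, is_derive t 1 (h i) (dh i)) ->
  is_derive t 1 (fun e => \sum_(i < m) h i e) (\sum_(i < m) dh i).
Proof.
move=> dh_h; have -> : (fun e => \sum_i h i e) = \sum_i h i.
  by apply/funext => e; rewrite fct_sumE.
exact: is_derive_sum.
Qed.

Lemma is_derive_mulmxr (m p r : nat) (M : R -> 'M[R]_(m, p)) t
    (dM : 'M[R]_(m, p)) (B : 'M[R]_(p, r)) :
  is_derive t 1 M dM -> is_derive t 1 (fun e => M e *m B) (dM *m B).
Proof.
move=> /is_derive_mxP dM_M; apply/is_derive_mxP => i j; rewrite mxE.
under eq_fun do rewrite mxE.
apply: is_derive_sumE => k; rewrite mulrC.
under eq_fun do rewrite mulrC.
exact: is_deriveZ.
Qed.

Lemma is_derive_continuous (V : normedModType R) (y : R -> V) t (dy : V) :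
  is_derive t 1 y dy -> {for t, continuous y}.
Proof.
by move=> ?; apply/differentiable_continuous/derivable1_diffP; exact: ex_derive.
Qed.

Lemma is_derive_line (m p : nat) (x v : 'M[R]_(m, p)) t :
  is_derive t 1 (fun e => x + e *: v) v.
Proof.
apply/is_derive_mxP => i j; under eq_fun do rewrite !mxE mulrC.
rewrite -[v i j in X in is_derive _ _ _ X]mulr1.
rewrite -[X in is_derive _ _ _ X]add0r.
by apply: is_deriveD; apply: is_deriveZ.
Qed.

End curves.

(** * One step of the method *)

Section one_step.
Context {R : realType} {N K s : nat}.
Variables (c : rk_coeffs R s).
Variables (f : 'cV[R]_N -> 'cV[R]_N) (sigma : 'cV[R]_N -> 'M[R]_(N, K)).
Variables (dt : R) (dz : 'cV[R]_K).
Hypotheses (smf : smooth_on setT f) (sms : smooth_on setT sigma).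

(** The stage equations and the update have the same shape, differing only in
    the weights [w] and [w']; this one computation differentiates both. *)
Lemma is_derive_rk_combination (w w' : 'I_s -> R) (y : R -> 'cV[R]_N)
    (Q : R -> 'I_s -> 'cV[R]_N) (t : R) (dy : 'cV[R]_N)
    (dQ : 'I_s -> 'cV[R]_N) :
  is_derive t 1 y dy ->
  (forall j, is_derive t 1 (fun e => Q e j) (dQ j)) ->
  is_derive t 1
    (fun e => y e + dt *: (\sum_j w j *: f (Q e j))
                  + \sum_j w' j *: (sigma (Q e j) *m dz))
    (dy + dt *: (\sum_j w j *: 'd f (Q t j) (dQ j))
        + \sum_j w' j *: ('d sigma (Q t j) (dQ j) *m dz)).
Proof.
move=> dy_y dQ_Q; apply: is_deriveD; first apply: is_deriveD => //.
  apply: is_deriveZ; apply: is_derive_sumE => j; apply: is_deriveZ.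
  by apply: is_derive_comp_curve => //; exact: smooth_on_differentiable smf _.
apply: is_derive_sumE => j; apply: is_deriveZ; apply: is_derive_mulmxr.
by apply: is_derive_comp_curve => //; exact: smooth_on_differentiable sms _.
Qed.

Variables (D : set 'cV[R]_N) (S : 'cV[R]_N -> 'I_s -> 'cV[R]_N).
Hypothesis smS : smooth_stage_map c f sigma dt dz D S.

(** Keeps perturbed trajectories inside the open set where the stages are
    known to solve their equations. *)
Lemma near_stage_domain (y : R -> 'cV[R]_N) (t : R) (dy : 'cV[R]_N) :
  is_derive t 1 y dy -> D (y t) -> \forall e \near t, D (y e).
Proof.
move=> /is_derive_continuous cy Dy; have [oD _ _] := smS.
by apply: cy; exact: open_nbhs_nbhs.
Qed.

Definition dstages (x v : 'cV[R]_N) : 'I_s -> 'cV[R]_N :=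
  fun i => 'd (fun x => S x i) x v.

Lemma is_derive_stages (y : R -> 'cV[R]_N) (t : R) (dy : 'cV[R]_N) i :
  is_derive t 1 y dy -> D (y t) ->
  is_derive t 1 (fun e => S (y e) i) (dstages (y t) dy i).
Proof.
move=> dy_y Dy; have [_ _ smSi] := smS.
apply: (@is_derive_comp_curve _ _ _ (fun x => S x i)) => //.
exact: smooth_on_differentiable (smSi i) Dy.
Qed.

(** The stages satisfy their equations at every point of a neighbourhood of
    [x], hence along the line through [x] in direction [v] for small times;
    two curves that agree near [0] have the same derivative there. *)
Lemma var_stage_eqs_dstages (x v : 'cV[R]_N) :
  D x -> var_stage_eqs c f sigma dt dz (S x) v (dstages x v).
Proof.
move=> Dx i; pose y (e : R) := x + e *: v.
have y0 : y 0 = x by rewrite /y scale0r addr0.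
have dy : is_derive (0 : R) 1 y v by exact: is_derive_line.
have Dy0 : D (y 0) by rewrite y0.
have dS j := is_derive_stages j dy Dy0.
have dC := is_derive_rk_combination (rk_a c i) (rk_abar c i) dy dS.
have [_ stS _] := smS.
have dS' : is_derive (0 : R) 1 (fun e => S (y e) i)
    (v + dt *: (\sum_j rk_a c i j *: 'd f (S (y 0) j) (dstages (y 0) v j))
       + \sum_j rk_abar c i j *: ('d sigma (S (y 0) j) (dstages (y 0) v j)
                                  *m dz)).
  apply: near_eq_is_derive dC; near=> e; rewrite -stS//.
  by near: e; exact: near_stage_domain dy Dy0.
rewrite y0 in dS'.
rewrite -(@derive_val _ _ _ _ _ _ _ dS').
by rewrite (@derive_val _ _ _ _ _ _ _ (dS i)) y0.
Unshelve. all: by end_near.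
Qed.

End one_step.

(** * Trajectories *)

Section many_steps.
Context {R : realType} {N K s : nat}.
Variables (c : rk_coeffs R s).
Variables (f : 'cV[R]_N -> 'cV[R]_N) (sigma : 'cV[R]_N -> 'M[R]_(N, K)).
Variables (n : nat) (dt : R) (dZ : nat -> 'cV[R]_K).
Variables (D : nat -> set 'cV[R]_N) (S : nat -> 'cV[R]_N -> 'I_s -> 'cV[R]_N).

(** The derivative of the discrete flow [rk_iter] at [x] in the direction [v],
    computed forward along the trajectory of [x]. *)
Fixpoint rk_diter (x v : 'cV[R]_N) (k : nat) : 'cV[R]_N :=
  if k is k'.+1 then
    let y := rk_iter c f sigma dt dZ S x k' in
    let w := rk_diter x v k' in
    var_update c f sigma dt (dZ k') (S k' y) w (dstages (S k') y w)
  else v.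

Hypotheses (smf : smooth_on setT f) (sms : smooth_on setT sigma).
Hypothesis smS : forall k, (k < n)%N ->
  smooth_stage_map c f sigma dt (dZ k) (D k) (S k).

Lemma rough_rk_iter (x : 'cV[R]_N) :
  (forall k, (k < n)%N -> D k (rk_iter c f sigma dt dZ S x k)) ->
  rough_rk c f sigma n dt dZ (rk_iter c f sigma dt dZ S x)
    (fun k => S k (rk_iter c f sigma dt dZ S x k)).
Proof.
by move=> Dx k kn; have [_ stS _] := smS kn; split=> //; exact/stS/Dx.
Qed.

Lemma variational_rk_diter (x v : 'cV[R]_N) :
  (forall k, (k < n)%N -> D k (rk_iter c f sigma dt dZ S x k)) ->
  variational_rough_rk c f sigma n dt dZ
    (fun k => S k (rk_iter c f sigma dt dZ S x k)) (rk_diter x v)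
    (fun k => dstages (S k) (rk_iter c f sigma dt dZ S x k) (rk_diter x v k)).
Proof.
move=> Dx k kn; split=> //.
exact (var_stage_eqs_dstages smf sms (smS kn) _ (Dx k kn)).
Qed.

(** Each step differentiates the update along the curve traced by the previous
    point, which need not be a line after the first step. *)
Lemma is_derive_rk_iter (x v : 'cV[R]_N) :
  (forall k, (k < n)%N -> D k (rk_iter c f sigma dt dZ S x k)) ->
  forall k, (k <= n)%N ->
  is_derive (0 : R) 1 (fun e => rk_iter c f sigma dt dZ S (x + e *: v) k)
    (rk_diter x v k).
Proof.
move=> Dx; elim=> [_|k IHk kn]; first exact: is_derive_line.
have dk := IHk (ltnW kn).
have x0 : x + 0 *: v = x by rewrite scale0r addr0.
have dS j := is_derive_stages (smS kn) j dk.
rewrite /= x0 in dS.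
have := is_derive_rk_combination dt (dZ k) smf sms (rk_b c) (rk_bbar c) dk
  (fun j => dS j (Dx k kn)).
by rewrite x0.
Qed.

(** Stage uniqueness is what makes the implicit variational method
    deterministic: equal points have equal stages, hence equal updates. *)
Lemma variational_rough_rk_inj (Q : nat -> 'I_s -> 'cV[R]_N)
    (dq dq' : nat -> 'cV[R]_N) (dQ dQ' : nat -> 'I_s -> 'cV[R]_N) :
  (forall k, (k < n)%N -> forall v, exists! w,
     var_stage_eqs c f sigma dt (dZ k) (Q k) v w) ->
  variational_rough_rk c f sigma n dt dZ Q dq dQ ->
  variational_rough_rk c f sigma n dt dZ Q dq' dQ' ->
  dq 0%N = dq' 0%N ->
  (forall k, (k <= n)%N -> dq k = dq' k) /\
  (forall k, (k < n)%N -> dQ k = dQ' k).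
Proof.
move=> wellp vdq vdq' dq0.
have eqQ k : (k < n)%N -> dq k = dq' k -> dQ k = dQ' k.
  move=> kn eqk; have [w [_ uw]] := wellp k kn (dq k).
  have [[st _] [st' _]] := (vdq k kn, vdq' k kn).
  by rewrite -(uw _ st) (uw (dQ' k))// eqk.
have eqq k : (k <= n)%N -> dq k = dq' k.
  elim: k => // k IHk kn; have eqk := IHk (ltnW kn).
  by rewrite (vdq k kn).2 (vdq' k kn).2 eqk (eqQ k kn eqk).
by split=> // k kn; exact/eqQ/eqq/ltnW.
Qed.

End many_steps.

Unset Implicit Arguments.
Set Strict Implicit.

Theorem corollary3p7 (R : realType) (N K s n : nat) (alpha T dt : R)
    (Z : R -> 'cV[R]_K) (ZZ : R -> R -> 'M[R]_K)
    (f : 'cV[R]_N -> 'cV[R]_N) (sigma : 'cV[R]_N -> 'M[R]_(N, K))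
    (qsol : R -> 'cV[R]_N) (c : rk_coeffs R s)
    (D : nat -> set 'cV[R]_N) (S : nat -> 'cV[R]_N -> 'I_s -> 'cV[R]_N)
    (dq0 : 'cV[R]_N) :
  let dZ := fun k : nat => incr Z (k%:R * dt) (k.+1%:R * dt) in
  let q := fun e : R => rk_iter c f sigma dt dZ S (qsol 0 + e *: dq0) in
  let Q := fun (e : R) (k : nat) => S k (q e k) in
  3^-1 < alpha -> alpha <= 2^-1 ->
  0 < dt -> n%:R * dt <= T ->
  geometric_rough_path alpha T Z ZZ ->
  smooth_on setT f -> smooth_on setT sigma ->
  rde_solution alpha T Z ZZ f sigma qsol ->
  (forall k, (k < n)%N -> smooth_stage_map c f sigma dt (dZ k) (D k) (S k)) ->
  (forall k, (k < n)%N -> D k (q 0 k)) ->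
  [/\ (* the perturbed families are trajectories of the method *)
      \forall e \near (0 : R), rough_rk c f sigma n dt dZ (q e) (Q e),
      (* the perturbation exists and is a trajectory of the variational method *)
      exists dq dQ, [/\ dq 0%N = dq0, is_perturbation n q Q dq dQ
        & variational_rough_rk c f sigma n dt dZ (Q 0) dq dQ]
    & (* when its stages are well defined, the variational method produces
         nothing else *)
      (forall k, (k < n)%N -> forall v, exists! w,
         var_stage_eqs c f sigma dt (dZ k) (Q 0 k) v w) ->
      forall dq dQ, dq 0%N = dq0 ->
        variational_rough_rk c f sigma n dt dZ (Q 0) dq dQ ->
        is_perturbation n q Q dq dQ].
Proof.
move=> dZ q Q _ _ _ _ _ smf sms _ smS DQ0.
have q0 : q 0 = rk_iter c f sigma dt dZ S (qsol 0).
  by rewrite /q scale0r addr0.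
have Dx k : (k < n)%N -> D k (rk_iter c f sigma dt dZ S (qsol 0) k).
  by rewrite -q0; exact: DQ0.
pose dq := rk_diter c f sigma dt dZ S (qsol 0) dq0.
pose dQ k := dstages (S k) (q 0 k) (dq k).
have dq_q := is_derive_rk_iter smf sms smS dq0 Dx.
have pert : is_perturbation n q Q dq dQ.
  split=> [k|k i] kn; first exact: dq_q.
  exact (is_derive_stages (smS k kn) i (dq_q k (ltnW kn)) (DQ0 k kn)).
have var : variational_rough_rk c f sigma n dt dZ (Q 0) dq dQ.
  rewrite /Q /dQ q0.
  exact (variational_rk_diter smf sms smS dq0 Dx).
split.
- have near_D (k : 'I_n) : \forall e \near (0 : R), D k (q e k).
    have kn := ltn_ord k.
    exact: (near_stage_domain (smS k kn) (dq_q k (ltnW kn)) (DQ0 k kn)).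
  near=> e; apply: (rough_rk_iter smS) => k kn.
  suff De : forall k : 'I_n, D k (q e k) by exact: (De (Ordinal kn)).
  by near: e; exact: filter_forall near_D.
- by exists dq, dQ.
- move=> wellp dq' dQ' dq'0 var'.
  have [eq_dq eq_dQ] := variational_rough_rk_inj wellp var' var dq'0.
  have [pert_q pert_Q] := pert.
  split=> [k|k i] kn; first by rewrite eq_dq//; exact: pert_q.
  by rewrite eq_dQ//; exact: pert_Q.
Unshelve. all: by end_near.
Qed.
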